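(* Let $t$ be a positive integer, let $R=\bigoplus_{\underline{n}\in\mathbb{N}^t}R_{\underline{n}}$ be a commutative Noetherian $\mathbb{N}^t$-graded ring with unity, and let $L=\bigoplus_{\underline{n}\in\mathbb{N}^t}L_{\underline{n}}$ be a finitely generated $\mathbb{N}^t$-graded $R$-module. Set $A=R_{(0,\ldots,0)}$. Then there exists a positive integer $l$ such that for any ideal $I$ of $A$, we have $$H_I^0(L_{\underline{n}})=\left(0:_{L_{\underline{n}}} I^l\right)\quad\text{for all } \underline{n}\in\mathbb{N}^t.$$ (The integer $l$ is independent of $I$ and $\underline{n}$.)
   Context: $\mathbb{N}$ denotes the set of non-negative integers. Each $L_{\underline{n}}$ is regarded as a module over $A=R_{(0,\ldots,0)}$. For an ideal $I$ of $A$ and an $A$-module $M$, $(0:_M I^n)=\{x\in M: I^n x=0\}$, and the $0$th local cohomology module of $M$ with respect to $I$ is $H_I^0(M):=\{x\in M : I^n x=0\text{ for some } n\in\mathbb{N}\}=\bigcup_{n\in\mathbb{N}}(0:_M I^n)$. *)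

(* Defs.v *)
From HB Require Import structures.
From mathcomp Require Import all_boot all_order all_algebra.
From mathcomp Require Import boolp classical_sets functions cardinality fsbigop.

Set Implicit Arguments.
Unset Strict Implicit.
Unset Printing Implicit Defensive.

Import GRing.Theory.
Local Open Scope classical_set_scope.
Local Open Scope ring_scope.

(* N^t, with the pointwise addition that {ffun _ -> nat} inherits from nat. *)
Notation multidegree t := {ffun 'I_t -> nat}.

Definition span (R : pzRingType) (M : lmodType R) (s : seq M) : set M :=
  [set x | exists a : 'I_(size s) -> R, x = \sum_(i < size s) a i *: s`_i].

Definition finitely_generated (R : pzRingType) (M : lmodType R) (N : set M) :=
  exists s : seq M, N = span s.

(* The ideals of the commutative ring R are the submodules of R^o. *)
Definition noetherian (R : comPzRingType) : Prop :=
  forall J : set R^o, GRing.submod_closed [in J] -> finitely_generated J.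

(* Internal direct sum: every element is, in a unique way, the sum of a
   finitely supported family of elements of the G n. *)
Definition direct_sum (t : nat) (V : zmodType) (G : multidegree t -> set V) :=
  (forall n, GRing.zmod_closed [in G n]) /\
  forall x : V, exists! c : multidegree t -> V,
    [/\ forall n, G n (c n), finite_set [set n | c n != 0]
      & x = \sum_(n \in [set: multidegree t]) c n].

(* 1 \in G 0 is not required: it follows from the two conditions. *)
Definition graded_ring (t : nat) (R : comPzRingType)
    (G : multidegree t -> set R) :=
  direct_sum G /\ forall m n a b, G m a -> G n b -> G (m + n) (a * b).

Definition graded_module (t : nat) (R : comPzRingType)
    (G : multidegree t -> set R) (L : lmodType R)
    (H : multidegree t -> set L) :=
  direct_sum H /\ forall m n a x, G m a -> H n x -> H (m + n) (a *: x).

(* A subring A of R, its ideals, and the A-submodules of an R-module are all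
   represented by their carriers, as subsets of R or of the module. *)
Definition ideal_of (R : comPzRingType) (A I : set R) :=
  [/\ I `<=` A, GRing.zmod_closed [in I]
    & forall a b, A a -> I b -> I (a * b)].

Definition ideal_mul (R : comPzRingType) (I J : set R) : set R :=
  [set x | exists2 s : seq (R * R),
     forall p, p \in s -> I p.1 /\ J p.2 & x = \sum_(p <- s) p.1 * p.2].

(* The power I^n taken in A; in particular I^0 = A. *)
Definition ideal_exp (R : comPzRingType) (A I : set R) (n : nat) : set R :=
  iter n (ideal_mul I) A.

(* (0 :_M J) *)
Definition colon0 (R : comPzRingType) (L : lmodType R) (M : set L)
    (J : set R) : set L :=
  [set x | M x /\ forall a, J a -> a *: x = 0].

(* H^0_I(M), for an ideal I of A and an A-submodule M of L *)
Definition local_cohomology0 (R : comPzRingType) (A I : set R)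
    (L : lmodType R) (M : set L) : set L :=
  \bigcup_(n in [set: nat]) colon0 M (ideal_exp A I n).

(* Main.v *)
(** The grading plays no role: for a submodule N of the Noetherian module L there
    is a single l such that, for every subset I of R and every k, an element
    sent into N by all products of k elements of I is sent into N by all
    products of l elements of I.  Argue by Noetherian induction on N.  If N is
    the intersection of two larger submodules, take the maximum of their two
    exponents.  Otherwise every a in R is nilpotent or a nonzerodivisor on L/N;
    the nilpotent elements form a finitely generated ideal P with P^l L in N.
    Either I lies in P, and products of l elements of I send L into N, or I
    contains a nonzerodivisor on L/N, and only elements of N are sent into N by
    a power of I.  The theorem is the case N = 0. *)

Require Import Defs.
From HB Require Import structures.
From mathcomp Require Import all_boot all_order all_algebra.
From mathcomp Require Import boolp classical_sets functions cardinality fsbigop.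

Set Implicit Arguments.
Unset Strict Implicit.
Unset Printing Implicit Defensive.

Import GRing.Theory.
Local Open Scope classical_set_scope.
Local Open Scope ring_scope.

(* The vector library has its own [span]. *)
Local Notation span := Defs.span.

(** * Submodules, spans and the ascending chain condition *)

Definition submodule (R : pzRingType) (M : lmodType R) (N : set M) :=
  N 0 /\ forall a u v, N u -> N v -> N (a *: u + v).

Definition noetherian_module (R : pzRingType) (M : lmodType R) :=
  forall N : set M, submodule N -> finitely_generated N.

Section Submodules.
Variables (R : pzRingType) (M : lmodType R).
Implicit Types (N : set M) (s : seq M).

Lemma submodule_closed N : submodule N -> GRing.submod_closed [in N].
Proof.
move=> [N0 NL]; split; first exact/mem_set.
by move=> a u v /set_mem Nu /set_mem Nv; apply/mem_set/NL.
Qed.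

Lemma submoduleD N u v : submodule N -> N u -> N v -> N (u + v).
Proof. by move=> [_ NL] Nu Nv; rewrite -[u]scale1r; apply: NL. Qed.

Lemma submoduleZ N a u : submodule N -> N u -> N (a *: u).
Proof. by move=> [N0 NL] Nu; rewrite -[_ *: _]addr0; apply: NL. Qed.

Lemma submoduleB N u v : submodule N -> N u -> N v -> N (u - v).
Proof.
move=> Nsub Nu Nv; rewrite -scaleN1r; apply: submoduleD => //.
exact: submoduleZ.
Qed.

Lemma span_nil : span [::] = [set (0 : M)]%classic.
Proof.
apply/seteqP; split=> [x [a ->]|x ->]; first by rewrite big_ord0.
by exists (fun=> 0); rewrite big_ord0.
Qed.

Lemma span_cons x s :
  span (x :: s) = [set z | exists a y, span s y /\ z = a *: x + y].
Proof.
apply/seteqP; split=> z /=.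
  case=> a ->; rewrite big_ord_recl /=.
  exists (a ord0), (\sum_(i < size s) a (lift ord0 i) *: s`_i); split=> //.
  by exists (fun i => a (lift ord0 i)).
move=> [a [y [[b ->] ->]]].
exists (fun i : 'I_(size s).+1 => if unlift ord0 i is Some j then b j else a).
rewrite big_ord_recl /= unlift_none; congr (_ + _).
by apply: eq_bigr => i _; rewrite liftK.
Qed.

Lemma span_submodule s : submodule (span s).
Proof.
elim: s => [|x s [s0 sL]].
  by rewrite span_nil; split=> // a u v -> ->; rewrite scaler0 addr0.
rewrite span_cons; split; first by exists 0, 0; rewrite scale0r addr0.
move=> a u v [b [y [sy ->]]] [c [z [sz ->]]].
exists (a * b + c), (a *: y + z); split; first exact: sL.
by rewrite scalerDr scalerA scalerDl addrACA.
Qed.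

Lemma mem_span s x : x \in s -> span s x.
Proof.
elim: s => // y s IHs; rewrite inE span_cons => /orP[/eqP->|/IHs sx].
  by exists 1, 0; rewrite scale1r addr0; split=> //; case: (span_submodule s).
by exists 0, x; rewrite scale0r add0r.
Qed.

Lemma span_min N s : submodule N -> {in s, forall x, N x} -> span s `<=` N.
Proof.
move=> Nsub; elim: s => [|y s IHs] Ns; first by rewrite span_nil => _ ->; case: Nsub.
rewrite span_cons => _ [a [z [sz ->]]].
apply: Nsub.2; first by apply: Ns; rewrite mem_head.
by apply: IHs sz => x xs; apply: Ns; rewrite inE xs orbT.
Qed.

Lemma submodule_bigcup (C : nat -> set M) :
  {homo C : m n / (m <= n)%N >-> m `<=` n} ->
  (forall n, submodule (C n)) -> submodule (\bigcup_n C n).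
Proof.
move=> Cmono Csub; split; first by exists 0%N => //; case: (Csub 0%N).
move=> a u v [m _ Cu] [n _ Cv]; exists (maxn m n) => //.
apply: (Csub _).2; first exact: (Cmono _ _ (leq_maxl _ _)) Cu.
exact: (Cmono _ _ (leq_maxr _ _)) Cv.
Qed.

(** The union of the chain is a submodule, hence finitely generated, and its finitely many
    generators already lie in a single term. *)
Lemma chain_stationary (C : nat -> set M) : noetherian_module M ->
  {homo C : m n / (m <= n)%N >-> m `<=` n} ->
  (forall n, submodule (C n)) -> exists n, forall m, C m `<=` C n.
Proof.
move=> Mnoeth Cmono Csub.
have [s Cs] := Mnoeth _ (submodule_bigcup Cmono Csub).
have sC : {in s, forall x, exists n, C n x}.
  by move=> x /mem_span; rewrite -Cs => -[n _ Cx]; exists n.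
have [n sCn] : exists n, {in s, forall x, C n x}.
  elim: s sC {Cs} => [|x s IHs] sC; first by exists 0%N.
  have [m Cx] := sC x (mem_head _ _).
  have [y ys|n Cs] := IHs; first by apply: sC; rewrite inE ys orbT.
  exists (maxn m n) => y; rewrite inE => /orP[/eqP->|/Cs Cy].
    exact: (Cmono _ _ (leq_maxl _ _)) Cx.
  exact: (Cmono _ _ (leq_maxr _ _)) Cy.
exists n => m x Cx; apply: (span_min (Csub n) sCn).
by rewrite -Cs; exists m.
Qed.

(** A submodule violating [P] has a strictly larger one violating [P]; iterating a choice of it
    gives a strictly ascending chain, which cannot become stationary. *)
Lemma noetherian_ind (P : set M -> Prop) : noetherian_module M ->
  (forall N, submodule N ->
    (forall N', submodule N' -> N `<` N' -> P N') -> P N) ->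
  forall N, submodule N -> P N.
Proof.
move=> Mnoeth Pind N0 N0sub; apply: contrapT => nPN0.
pose T := {N : set M | submodule N /\ ~ P N}.
have next (N : T) : {N' : T | sval N `<` sval N'}.
  apply: cid; case: N => N [Nsub nPN] /=; apply: contrapT => nN'.
  apply: nPN; apply: Pind => // N' N'sub NN'; apply: contrapT => nPN'.
  by apply: nN'; exists (exist _ N' (conj N'sub nPN')).
pose C n := sval (iter n (fun K : T => sval (next K)) (exist _ N0 (conj N0sub nPN0) : T)).
have CS n : C n `<` C n.+1 by rewrite /C iterS; case: (next _).
have [||n Cn] := @chain_stationary C Mnoeth.
- apply: (homo_leq (fun A => @subset_refl _ A)) => [A B D|n]; first exact: subset_trans.
  exact: (CS n).1.
- by move=> n; rewrite /C; case: (iter _ _ _) => N [].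
exact: (CS n).2 (Cn n.+1).
Qed.

End Submodules.

(** * Finitely generated modules over a Noetherian ring *)

Lemma noetherian_fg (R : pzRingType) (M : lmodType R) :
  noetherian_module R^o -> finitely_generated [set: M] -> noetherian_module M.
Proof.
move=> Rnoeth [s Ms] N Nsub.
have {Ms} : N `<=` span s by rewrite -Ms.
elim: s N Nsub => [|x s IHs] N Nsub Ns.
  exists [::]; apply/seteqP; split=> // x.
  by rewrite span_nil => ->; exact: Nsub.1.
(* [J] is the ideal of coefficients of [x] in elements of [N], so [N] is an extension of [J] by the
   part of [N] inside [span s]. *)
pose J : set R^o := [set a | exists2 y, span s y & N (a *: x + y)].
have sS := span_submodule s.
have Jsub : submodule J.
  split; first by exists 0; [exact: sS.1 | rewrite scale0r addr0; exact: Nsub.1].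
  move=> a b c [y sy Ny] [z sz Nz]; exists (a *: y + z); first exact: sS.2.
  by rewrite scalerDl -scalerA addrACA -scalerDr; exact: Nsub.2.
have [r Jr] := Rnoeth _ Jsub.
have [u Nu] : finitely_generated (N `&` span s).
  apply: IHs; last by move=> ? [].
  split; first by split; [exact: Nsub.1 | exact: sS.1].
  by move=> a v w [Nv sv] [Nw sw]; split; [exact: Nsub.2 | exact: sS.2].
(* The list [z] lifts the generators [r] of [J] to elements of [N]; its span realises every
   coefficient in [J], up to [span s]. *)
have [z zN zr] : exists2 z : seq M, {in z, forall w, N w} &
    forall a : R, span r (a : R^o) -> exists2 w, span z w & span s (w - a *: x).
  have : {in r, forall a, J a} by move=> a /mem_span; rewrite -Jr.
  elim: r {Jr} => [|b r IHr] Jr.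
    exists [::] => // a; rewrite span_nil => ->; exists 0.
      by rewrite span_nil.
    by rewrite scale0r subr0; exact: sS.1.
  have [|z zN zr] := IHr; first by move=> a ar; apply: Jr; rewrite inE ar orbT.
  have [y sy Ny] := Jr b (mem_head _ _).
  exists (((b : R) *: x + y) :: z).
    by move=> w; rewrite inE => /orP[/eqP->//|/zN].
  move=> a; rewrite span_cons => -[c [d [/(zr (d : R))[w zw sw] ->]]].
  exists (c *: ((b : R) *: x + y) + w).
    by rewrite span_cons; exists c, w.
  have -> : c *: ((b : R) *: x + y) + w - (c * b + d : R) *: x
      = c *: y + (w - (d : R) *: x).
    by rewrite scalerDl -scalerA scalerDr opprD addrACA [c *: _ + c *: y]addrC addrK.
  exact: sS.2.
exists (z ++ u); apply/seteqP; split; last first.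
  apply: span_min => // w; rewrite mem_cat => /orP[/zN //|/mem_span].
  by rewrite -Nu => -[].
have catS := span_submodule (z ++ u).
(* Subtracting from [w] a combination [v] of [z] with the same coefficient of [x] leaves an element
   of [N] in [span s], that is, of [span u]. *)
move=> w Nw; have := Ns w Nw; rewrite span_cons => -[a [y [sy wE]]].
have /zr[v zv sv] : span r a by rewrite -Jr; exists y => //; rewrite -wE.
have Nv : N v by apply: span_min zv.
rewrite -(subrK v w); apply: submoduleD => //; last first.
  by apply: span_min zv => // v' v'z; apply: mem_span; rewrite mem_cat v'z.
have : span u (w - v).
  rewrite -Nu; split; first exact: submoduleB.
  have -> : w - v = y - (v - a *: x) by rewrite wE opprB addrA [y + _]addrC.
  exact: submoduleB.
by apply: span_min => // v' v'u; apply: mem_span; rewrite mem_cat v'u orbT.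
Qed.

(** * Products of elements of a subset, acting modulo a submodule *)

Section UniformExponent.
Variables (R : comPzRingType) (M : lmodType R).
Implicit Types (N : set M) (I J : set R).

(** For an ideal [I] of [R] this is (N :_M I^n). Testing on products of [n] elements makes sense for
    any subset [I], in particular for singletons and for ideals of a subring. *)
Definition power_colon N I (n : nat) : set M :=
  [set x | forall s : seq R, size s = n -> {in s, forall a, I a} ->
    N ((\prod_(a <- s) a) *: x)].

Definition uniform_exponent N :=
  exists l, forall I k, power_colon N I k `<=` power_colon N I l.

(** For an ideal [J], this says that some power of [J] annihilates M/N. *)
Definition nilpotent_mod N J := exists l, power_colon N J l = setT.

Lemma power_colon_le N I m n : submodule N -> (m <= n)%N ->
  power_colon N I m `<=` power_colon N I n.
Proof.
move=> Nsub mn x Nx s sn Is; rewrite -(cat_take_drop m s) big_cat /=.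
rewrite mulrC -scalerA; apply: submoduleZ => //; apply: Nx.
  by rewrite size_takel ?sn.
by move=> a /mem_take/Is.
Qed.

(** When a product of [l + m] sums is expanded, each term has at least [l] factors from [I] or at
    least [m] from [J]. *)
Lemma nilpotent_modD N I J : submodule N ->
  nilpotent_mod N I -> nilpotent_mod N J ->
  nilpotent_mod N [set c | exists a b, [/\ I a, J b & c = a + b]].
Proof.
move=> Nsub [l Il] [m Jm]; exists (l + m)%N; apply/seteqP; split=> // x _ s sn Is.
(* Invariant of the expansion: [s] holds the sums not yet expanded, [u] and [v] the factors already
   picked from [I] and [J]. *)
have killed u v : {in u, forall a, I a} -> {in v, forall b, J b} ->
    (l + m <= size s + size u + size v)%N ->
    N ((\prod_(c <- s) c * \prod_(a <- u) a * \prod_(b <- v) b) *: x).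
  elim: s u v {sn} Is => [|c s IHs] u v Is Iu Jv lm.
    rewrite big_nil mul1r; have [lu|ul] := leqP l (size u).
      rewrite mulrC -scalerA; apply: submoduleZ => //.
      by apply: (power_colon_le Nsub lu _ erefl Iu); rewrite Il.
    rewrite -scalerA; apply: submoduleZ => //.
    have mv : (m <= size v)%N.
      by rewrite add0n in lm; rewrite -(leq_add2l l) (leq_trans lm)// leq_add2r ltnW.
    by apply: (power_colon_le Nsub mv _ erefl Jv); rewrite Jm.
  have [a [b [Ia Jb cE]]] := Is c (mem_head _ _).
  have Is' : {in s, forall c, exists a b, [/\ I a, J b & c = a + b]}.
    by move=> c' c's; apply: Is; rewrite inE c's orbT.
  have -> : \prod_(c <- c :: s) c * \prod_(a <- u) a * \prod_(b <- v) b =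
      \prod_(c <- s) c * \prod_(a <- a :: u) a * \prod_(b <- v) b +
      \prod_(c <- s) c * \prod_(a <- u) a * \prod_(b <- b :: v) b.
    rewrite !big_cons cE !mulrDl; congr (_ + _); rewrite -?mulrA; last first.
      by rewrite mulrCA; congr (_ * _); rewrite mulrCA.
    by rewrite mulrCA.
  rewrite scalerDl; apply: submoduleD => //; apply: IHs => //=.
  - by move=> d; rewrite inE => /orP[/eqP->|/Iu].
  - by rewrite addnS addSn; rewrite /= !addSn in lm.
  - by move=> d; rewrite inE => /orP[/eqP->|/Jv].
  - by rewrite addnS; rewrite /= !addSn in lm.
have := killed [::] [::]; rewrite !big_nil !mulr1; apply=> //.
by rewrite sn !addn0.
Qed.

Lemma power_colon1 N a k : power_colon N [set a] k = [set x | N (a ^+ k *: x)].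
Proof.
apply/seteqP; split=> x Nx.
  move/(_ (nseq k a)): Nx; rewrite big_nseq -Monoid.iteropE; apply.
    by rewrite size_nseq.
  by move=> b; rewrite mem_nseq => /andP[_ /eqP->].
move=> s sk sa; have -> : s = nseq k a.
  by rewrite -sk; apply/all_pred1P/allP => b /sa ->; rewrite /= eqxx.
by rewrite big_nseq -Monoid.iteropE.
Qed.

Lemma nilpotent_modZ N a : submodule N -> nilpotent_mod N [set a] ->
  nilpotent_mod N [set c | exists r, c = r * a].
Proof.
move=> Nsub [l al]; exists l; apply/seteqP; split=> // x _ s sl sa.
have [r ->] : exists r, \prod_(c <- s) c = r * a ^+ l.
  elim: s l {al} sl sa => [|c s IHs] [|l] //=; first by exists 1; rewrite big_nil mul1r.
  case=> sl sa; have [r sE] := sa c (mem_head _ _).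
  have [q qE] : exists q, \prod_(c <- s) c = q * a ^+ l.
    by apply: IHs => // d ds; apply: sa; rewrite inE ds orbT.
  by exists (r * q); rewrite big_cons qE sE exprS mulrACA.
rewrite -scalerA; apply: submoduleZ => //.
have : power_colon N [set a] l x by rewrite al.
by rewrite power_colon1.
Qed.

Lemma nilpotent_mod_sub N I J : I `<=` J -> nilpotent_mod N J -> nilpotent_mod N I.
Proof.
move=> IJ [l Jl]; exists l; apply/seteqP; split=> // x _ s sl Is.
have : power_colon N J l x by rewrite Jl.
by apply=> // a /Is/IJ.
Qed.

(** The radical of the annihilator of M/N, typed in [R^o] so that ideals are submodules. *)
Definition nilradical_mod N : set R^o := [set a : R | nilpotent_mod N [set a]].

Lemma nilradical_submodule N : submodule N -> submodule (nilradical_mod N).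
Proof.
move=> Nsub; split.
  exists 1%N; rewrite power_colon1; apply/seteqP; split=> // x _ /=.
  by rewrite expr1 scale0r; exact: Nsub.1.
move=> a u v Nu Nv.
apply: nilpotent_mod_sub (nilpotent_modD Nsub (nilpotent_modZ Nsub Nu) Nv).
by move=> _ ->; exists (a * u), v; split=> //; exists a.
Qed.

Lemma nilpotent_mod_span N (s : seq R^o) : submodule N ->
  {in s, forall a : R, nilpotent_mod N [set a]} -> nilpotent_mod N (span s).
Proof.
move=> Nsub; elim: s => [|a s IHs] sN.
  rewrite span_nil; exact: (nilradical_submodule Nsub).1.
have aN : nilpotent_mod N [set (a : R)] by apply: sN; rewrite mem_head.
have {IHs} sN' : nilpotent_mod N (span s).
  by apply: IHs => b bs; apply: sN; rewrite inE bs orbT.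
apply: nilpotent_mod_sub (nilpotent_modD Nsub (nilpotent_modZ Nsub aN) sN').
rewrite span_cons => _ [b [y [sy ->]]].
by exists (b * a), y; split=> //; exists b.
Qed.

(** The radical has finitely many generators, each nilpotent modulo [N], and nilpotency passes to
    multiples and sums. *)
Lemma nilradical_nilpotent N : noetherian_module R^o -> submodule N ->
  nilpotent_mod N (nilradical_mod N).
Proof.
move=> Rnoeth Nsub; have [s Ns] := Rnoeth _ (nilradical_submodule Nsub).
rewrite Ns; apply: nilpotent_mod_span => // a /mem_span.
by rewrite -Ns.
Qed.

(** * Existence of the uniform exponent *)

Lemma uniform_exponent_primary N : noetherian_module R^o -> submodule N ->
  (forall a, nilpotent_mod N [set a] \/ forall x, N (a *: x) -> N x) ->
  uniform_exponent N.
Proof.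
move=> Rnoeth Nsub Nprim; have [l Pl] := nilradical_nilpotent Rnoeth Nsub.
exists l => I k x Ix.
have [IP|/existsNP[a /not_implyP[Ia naP]]] := pselect (I `<=` nilradical_mod N).
  move=> s sl Is; have : power_colon N (nilradical_mod N) l x by rewrite Pl.
  by apply=> // a /Is/IP.
have [//|aN] := Nprim a.
have : N (a ^+ k *: x).
  have : power_colon N [set a] k x.
    by move=> s sk sa; apply: Ix => // b /sa ->.
  by rewrite power_colon1.
move=> akx; have Nx : N x.
  elim: k akx {Ix} => [|k IHk]; first by rewrite expr0 scale1r.
  by rewrite exprS -scalerA => /aN/IHk.
by move=> s _ _; apply: submoduleZ.
Qed.

(* With (N : a^k) stable, N is the intersection of (N : a^k) and N + a^k M. *)
Lemma submodule_decomposition N (a : R) : noetherian_module M -> submodule N ->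
  ~ nilpotent_mod N [set a] -> ~ (forall x, N (a *: x) -> N x) ->
  exists N1 N2, [/\ submodule N1, submodule N2, N `<` N1, N `<` N2
    & N1 `&` N2 `<=` N].
Proof.
move=> Mnoeth Nsub anil adiv.
pose C k : set M := [set x | N (a ^+ k *: x)].
have Csub k : submodule (C k).
  split=> [|b u v Nu Nv]; first by rewrite /C /= scaler0; exact: Nsub.1.
  by rewrite /C /= scalerDr scalerA mulrC -scalerA; exact: Nsub.2.
have Cmono : {homo C : m n / (m <= n)%N >-> m `<=` n}.
  move=> m n mn x Nx; rewrite /C /= -(subnK mn) exprD -scalerA.
  exact: submoduleZ.
have [k Ck] := chain_stationary Mnoeth Cmono Csub.
pose D : set M := [set x | exists y z, N y /\ x = y + a ^+ k *: z].
have NC : N `<=` C k by move=> x Nx; apply: submoduleZ.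
have ND : N `<=` D by move=> x Nx; exists x, 0; rewrite scaler0 addr0.
exists (C k), D; split=> //.
- split=> [|b u v [y [z [Ny ->]]] [y' [z' [Ny' ->]]]]; first exact/ND/Nsub.1.
  exists (b *: y + y'), (b *: z + z'); split; first exact: Nsub.2.
  by rewrite !scalerDr !scalerA [b * _]mulrC addrACA.
(* If [C k] were [N], then [C 1], which lies in [C k], would be too, and [a] could be cancelled
   modulo [N]. *)
- split=> // CN; apply: adiv => x ax; apply: CN; apply: (Ck 1%N).
  by rewrite /C /= expr1.
(* If [D] were [N], then a^k M would lie in [N]. *)
- split=> // DN; apply: anil; exists k; rewrite power_colon1.
  apply/seteqP; split=> // x _; apply: DN.
  by exists 0, x; rewrite add0r; split=> //; exact: Nsub.1.
(* Write x = y + a^k z. From a^k x and y in [N] follows a^(2k) z in [N]; stability of the chain at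
   [k] then gives a^k z in [N]. *)
move=> x [Cx [y [z [Ny xE]]]]; move: Cx; rewrite {x}xE /C /= scalerDr => Nyz.
apply: submoduleD => //; apply: (Ck (k + k)%N).
rewrite /C /= exprD -scalerA -(addrK (a ^+ k *: y) (a ^+ k *: _)).
by apply: submoduleB => //; [rewrite addrC | exact: submoduleZ].
Qed.

Lemma noetherian_uniform_exponent N :
  noetherian_module R^o -> noetherian_module M -> submodule N ->
  uniform_exponent N.
Proof.
move=> Rnoeth Mnoeth; move: N; apply: (noetherian_ind Mnoeth) => N Nsub IH.
have [prim|/existsNP[a /not_orP[anil adiv]]] := pselect
  (forall a, nilpotent_mod N [set a] \/ forall x, N (a *: x) -> N x).
  exact: uniform_exponent_primary.
have [N1 [N2 [N1sub N2sub NN1 NN2 N12]]] :=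
  submodule_decomposition Mnoeth Nsub anil adiv.
have [[l1 Nl1] [l2 Nl2]] := (IH _ N1sub NN1, IH _ N2sub NN2).
exists (maxn l1 l2) => I k x Ix s sl Is; apply: N12; split.
  apply: (power_colon_le N1sub (leq_maxl l1 l2)) sl Is.
  by apply: (Nl1 I k) => u uk Iu; apply: NN1.1; apply: Ix.
apply: (power_colon_le N2sub (leq_maxr l1 l2)) sl Is.
by apply: (Nl2 I k) => u uk Iu; apply: NN2.1; apply: Ix.
Qed.

(** * From products of elements to powers of ideals *)

Lemma power_colon_ideal_exp (A I : set R) k x :
  power_colon [set 0] I k x -> forall c, ideal_exp A I k c -> c *: x = 0.
Proof.
elim: k x => [|k IHk] x Ix c.
  have : (\prod_(b <- [::]) b : R) *: x = 0 by apply: Ix.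
  by rewrite big_nil scale1r => ->; rewrite scaler0.
(* In each summand the factor [p.1] from [I] is absorbed into [x]: the element [p.1 *: x] meets the
   hypothesis with exponent [k]. *)
move=> [s sIk ->]; rewrite scaler_suml big_seq big1 // => p /sIk[Ip Ikp].
rewrite mulrC -scalerA; apply: IHk Ikp => u uk Iu.
rewrite scalerA mulrC -(big_cons _ _ p.1 u xpredT id); apply: Ix => /=; first by rewrite uk.
by move=> b; rewrite inE => /orP[/eqP->|/Iu].
Qed.

(** Since [ideal_exp] starts from [A], the last of [k.+1] factors from [I] serves as the element of
    [A], and the product lies in [ideal_exp A I k]; hence the shift by one. *)
Lemma ideal_exp_power_colon (A I : set R) k x : I `<=` A ->
  (forall c, ideal_exp A I k c -> c *: x = 0) -> power_colon [set 0] I k.+1 x.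
Proof.
move=> IA Ix s sk Is; apply: Ix.
elim: k s sk Is => [|k IHk] [|a s] //= [sk] Is.
  by rewrite big_cons (size0nil sk) big_nil mulr1; apply/IA/Is/mem_head.
exists [:: (a, \prod_(c <- s) c)]; last by rewrite big_seq1 big_cons.
move=> p; rewrite inE => /eqP-> /=; split; first exact/Is/mem_head.
by apply: IHk => // b bs; apply: Is; rewrite inE bs orbT.
Qed.

End UniformExponent.

Theorem theorem3p1 (t : nat) (t_gt0 : (0 < t)%N)
    (R : comPzRingType) (RG : multidegree t -> set R)
    (R_noeth : noetherian R) (R_graded : graded_ring RG)
    (L : lmodType R) (LG : multidegree t -> set L)
    (L_graded : graded_module RG LG)
    (L_fg : finitely_generated [set: L]) :
  exists l : nat, (0 < l)%N /\
    forall I : set R, ideal_of (RG 0) I ->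
    forall n : multidegree t,
      local_cohomology0 (RG 0) I (LG n) = colon0 (LG n) (ideal_exp (RG 0) I l).
Proof.
have Rnoeth : noetherian_module R^o.
  by move=> J Jsub; apply: R_noeth; exact: submodule_closed.
have Lnoeth := noetherian_fg Rnoeth L_fg.
have sub0 : submodule [set (0 : L)]%classic.
  by split=> // a u v -> ->; rewrite scaler0 addr0.
have [l Ll] := noetherian_uniform_exponent Rnoeth Lnoeth sub0.
(* [l] may be 0; its successor is positive and still works because [power_colon] grows with the
   exponent. *)
exists l.+1; split=> // I [IA _ _] n; apply/seteqP; split=> x; last first.
  by move=> Lx; exists l.+1.
move=> [k _ [Lx Ix]]; split=> //; apply: power_colon_ideal_exp.
apply: (power_colon_le sub0 (leqnSn l)); apply: (Ll I k.+1).
exact: ideal_exp_power_colon Ix.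
Qed.
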